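(* Let $X$ be a separable real Banach space which contains a closed subspace isomorphic to $\ell_1$. Then there is an equivalent norm on $X$ such that the bidual $X^{**}$, endowed with the bidual norm of this new norm, is octahedral.
   Context: All Banach spaces are real. $S_X$ denotes the unit sphere of $X$. A Banach space $(X,\|\cdot\|)$ (or its norm) is called octahedral if for every finite-dimensional subspace $E$ of $X$ and every $\varepsilon>0$ there is $y\in S_X$ such that $\|x+y\|\ge(1-\varepsilon)(\|x\|+\|y\|)$ for all $x\in E$. *)

(* Defs.v *)
From HB Require Import structures.
From mathcomp Require Import all_boot all_order all_algebra.
From mathcomp Require Import all_classical all_reals all_analysis.

Set Implicit Arguments.
Unset Strict Implicit.
Unset Printing Implicit Defensive.

Import Order.TTheory GRing.Theory Num.Theory.
Import numFieldNormedType.Exports.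

Local Open Scope classical_set_scope.
Local Open Scope ring_scope.

Section Dual.
Context {R : realType} (X : normedModType R).

Definition dual_pred : {pred X -> R^o} :=
  mem [set f : X -> R^o | linear f /\ continuous f].

Lemma dual_pred_submod_closed : submod_closed dual_pred.
Proof.
split.
  rewrite inE /=; split; first by move=> a u v; rewrite scaler0 addr0.
  by move=> x; exact: cvg_cst.
move=> a f g; rewrite !inE /= => -[lf cf] [lg cg]; split.
  move=> b u v.
  change (a *: f (b *: u + v) + g (b *: u + v) =
    b *: (a *: f u + g u) + (a *: f v + g v)).
  by rewrite lf lg !scalerDr !scalerA [a * b]mulrC addrACA.
by move=> x; apply: cvgD; [apply: cvgZr; exact: cf | exact: cg].
Qed.

HB.instance Definition _ :=
  GRing.isSubmodClosed.Build R (X -> R^o) dual_pred dual_pred_submod_closed.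

Record dual : Type :=
  Dual { dual_fun :> X -> R^o; dual_funP : dual_fun \in dual_pred }.

HB.instance Definition _ := [isSub for dual_fun].
HB.instance Definition _ := [Choice of dual by <:].
HB.instance Definition _ := [SubChoice_isSubLmodule of dual by <:].

Lemma dual_linear (f : dual) : linear f.
Proof. by have := dual_funP f; rewrite inE => -[]. Qed.

Lemma dual_continuous (f : dual) : continuous f.
Proof. by have := dual_funP f; rewrite inE => -[]. Qed.

HB.instance Definition _ (f : dual) :=
  GRing.isLinear.Build R X R^o *:%R (dual_fun f) (dual_linear f).

Definition dual_norm (f : dual) : R := sup [set `|f x| | x in [set x | `|x| <= 1]].

Lemma dual_norm_has_sup (f : dual) :
  has_sup [set `|f x| | x in [set x | `|x| <= 1]].
Proof.
split; first by exists `|f 0|, 0 => //=; rewrite normr0.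
have /linear_bounded_continuous/bounded_funP/(_ 1)[M fM] := @dual_continuous f.
by exists M => _ [x /= x1 <-]; exact: fM.
Qed.

Lemma dual_norm_ub (f : dual) x : `|x| <= 1 -> `|f x| <= dual_norm f.
Proof.
by move=> x1; apply: (sup_upper_bound (dual_norm_has_sup f)); exists x.
Qed.

Lemma dual_norm_le (f : dual) M :
  (forall x, `|x| <= 1 -> `|f x| <= M) -> dual_norm f <= M.
Proof.
move=> fM; apply: ge_sup; first by case: (dual_norm_has_sup f).
by move=> _ [x x1 <-]; exact: fM.
Qed.

Lemma dual_norm_ge0 f : 0 <= dual_norm f.
Proof. by apply: le_trans (dual_norm_ub f (x := 0) _); rewrite ?normr0. Qed.

Lemma dual_normD f g : dual_norm (f + g) <= dual_norm f + dual_norm g.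
Proof.
apply: dual_norm_le => x x1; apply: (le_trans (ler_normD (f x) (g x))).
by rewrite lerD// dual_norm_ub.
Qed.

Lemma dual_normZ_le a f : dual_norm (a *: f) <= `|a| * dual_norm f.
Proof.
apply: dual_norm_le => x x1.
change (`|a * f x| <= `|a| * dual_norm f).
by rewrite normrM ler_wpM2l// dual_norm_ub.
Qed.

Lemma dual_normZ a f : dual_norm (a *: f) = `|a| * dual_norm f.
Proof.
apply/eqP; rewrite eq_le dual_normZ_le /=.
have [->|a0] := eqVneq a 0; first by rewrite normr0 mul0r dual_norm_ge0.
rewrite -ler_pdivlMl ?normr_gt0// -normfV.
by rewrite -{1}(scalerK a0 f) dual_normZ_le.
Qed.

Lemma dual_norm_eq0 f : dual_norm f = 0 -> f = 0.
Proof.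
move=> f0; apply/val_inj/funext => x /=; apply/eqP.
change (f x == 0).
have [->|x0] := eqVneq x 0; first by rewrite linear0.
have : `|f (`|x|^-1 *: x)| <= dual_norm f.
  by apply: dual_norm_ub; rewrite normrZ normfV normr_id mulVf ?normr_eq0.
rewrite f0 normr_le0 linearZ /= mulf_eq0 invr_eq0 normr_eq0.
by rewrite (negbTE x0).
Qed.

HB.instance Definition _ := @Lmodule_isNormed.Build R dual
  dual_norm dual_normD dual_normZ dual_norm_eq0.

End Dual.

Section L1.
Context (R : realType).

Definition l1_pred : {pred nat -> R^o} :=
  mem [set u : nat -> R^o | cvgn [normed series u]].

Lemma l1_pred_submod_closed : submod_closed l1_pred.
Proof.
split.
  rewrite inE /=; apply/cvg_ex; exists 0; apply: cvg_near_cst.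
  near=> n; rewrite /= /series /=; apply: big1 => i _.
  exact: normr0.
move=> a u v; rewrite !inE /= => cu cv.
have cau := @is_cvg_seriesZ _ _ `|a| cu.
apply: series_le_cvg (is_cvg_seriesD cau cv) => n.
- exact: normr_ge0.
- exact: addr_ge0 (mulr_ge0 (normr_ge0 a) (normr_ge0 (u n))) (normr_ge0 (v n)).
- change (`|a * u n + v n| <= `|a| * `|u n| + `|v n|).
  by rewrite -normrM ler_normD.
Unshelve. all: by end_near. Qed.

HB.instance Definition _ :=
  GRing.isSubmodClosed.Build R (nat -> R^o) l1_pred l1_pred_submod_closed.

Record l1 : Type :=
  L1 { l1_seq :> nat -> R^o; l1_seqP : l1_seq \in l1_pred }.

HB.instance Definition _ := [isSub for l1_seq].
HB.instance Definition _ := [Choice of l1 by <:].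
HB.instance Definition _ := [SubChoice_isSubLmodule of l1 by <:].

Definition l1_norm (u : l1) : R := limn [normed series u].

Lemma l1_cvg (u : l1) : cvgn [normed series u].
Proof. by have := l1_seqP u; rewrite inE. Qed.
Arguments l1_cvg : clear implicits.

Lemma l1_normZ a u : l1_norm (a *: u) = `|a| * l1_norm u.
Proof.
rewrite /l1_norm -[RHS](lim_seriesZ `|a| (l1_cvg u)).
congr (lim (series _ @ \oo)); apply/funext => n.
by rewrite /= -[RHS]normrM.
Qed.

Lemma l1_normD u v : l1_norm (u + v) <= l1_norm u + l1_norm v.
Proof.
rewrite /l1_norm -[leRHS](lim_seriesD (l1_cvg u) (l1_cvg v)).
apply: lim_series_le (l1_cvg (u + v)) _ _ => [|n].
  exact: is_cvg_seriesD (l1_cvg u) (l1_cvg v).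
exact: (ler_normD (u n) (v n)).
Qed.

Lemma l1_norm_eq0 u : l1_norm u = 0 -> u = 0.
Proof.
move=> u0; apply/val_inj/funext => n /=; apply/eqP.
change (u n == 0); rewrite -normr_le0 -u0.
have le_ser : `|u n| <= [normed series u] n.+1.
  change (`|u n| <= \sum_(0 <= k < n.+1) `|u k|).
  by rewrite big_nat_recr//= lerDr sumr_ge0.
apply: (le_trans le_ser); apply: nondecreasing_cvgn_le (l1_cvg u) _ => //.
rewrite /series; apply/nondecreasing_seqP => m.
change (\sum_(0 <= k < m) `|u k| <= \sum_(0 <= k < m.+1) `|u k|).
by rewrite big_nat_recr//= lerDl.
Qed.

HB.instance Definition _ := @Lmodule_isNormed.Build R l1
  l1_norm l1_normD l1_normZ l1_norm_eq0.

End L1.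

Section Renorming.
Context {R : realType} (X : normedModType R).

Record equivalent_norm := EquivalentNorm {
  enorm :> X -> R;
  enormD : forall x y, enorm (x + y) <= enorm x + enorm y;
  enormZ : forall a x, enorm (a *: x) = `|a| * enorm x;
  enorm_eq0 : forall x, enorm x = 0 -> x = 0;
  enorm_equiv : exists c C : R,
    [/\ 0 < c, 0 < C & forall x, c * `|x| <= enorm x <= C * `|x|] }.

(* The vector space X, with its norm forgotten and replaced by N. *)
Definition renormed (N : equivalent_norm) : Type := X.

HB.instance Definition _ N := GRing.Lmodule.copy (renormed N) X.
HB.instance Definition _ N := @Lmodule_isNormed.Build R (renormed N)
  (enorm N) (@enormD N) (@enormZ N) (@enorm_eq0 N).

End Renorming.

Definition separable (T : topologicalType) :=
  exists D : set T, countable D /\ dense D.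

(* A linear homeomorphism from V onto Y; its range Y is thus a subspace of W. *)
Definition isomorphic_to_subspace {R : realType} (V W : normedModType R)
    (Y : set W) :=
  exists (T : {linear V -> W}) (S : W -> V),
    [/\ range T = Y, cancel T S, continuous T & {within Y, continuous S}].

Definition finite_dimensional_subspace {R : realType} (X : normedModType R)
    (E : set X) :=
  exists (n : nat) (e : 'I_n -> X),
    E = [set \sum_(i < n) a i *: e i | a in [set: 'I_n -> R]].

Definition octahedral {R : realType} (X : normedModType R) :=
  forall (E : set X) (eps : R), finite_dimensional_subspace E -> 0 < eps ->
    exists y : X, `|y| = 1 /\
      forall x, E x -> (1 - eps) * (`|x| + `|y|) <= `|x + y|.

(* Main.v *)
From HB Require Import structures.
Require Import Defs.
From mathcomp Require Import all_boot all_order all_algebra finmap lra ring.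
From mathcomp Require Import all_classical all_reals all_analysis.
Import Order.TTheory GRing.Theory Num.Theory.
Import numFieldNormedType.Exports.
Local Open Scope classical_set_scope.
Local Open Scope ring_scope.

(* Let (e_n) in X be equivalent to the l1 basis.  By Hahn-Banach there are, for
   every L and every sign vector s in {-1,1}^L, functionals k_s of norm at most
   B with k_s(e_i) = s_i for i < L.  For a in [-1/2,1/2]^N let g_a be the limit,
   along an ultrafilter in L, of the averages of k_s against the product measure
   on {-1,1}^L whose i-th marginal has mean a_i; then g_a(e_n) = a_n.  Changing
   the coordinate a_n multiplies the density by 1 + psi_n, where the psi_n are
   bounded, centred and independent; being orthogonal in L^2, they satisfy
     |sum_(n < m) t_n (g_(a with a_n changed) - g_a)| <= 2 B sqrt m  if |t_n| <= 1.
   The new norm is N(x) = sup (+- g_a(x) + h(x)) over all a and all h in the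
   dual ball vanishing on every e_n.

   Given f in the dual ball of N, applying Hahn-Banach on X * X^m to the supremum
   over the generators of N and of their perturbations transfers this estimate to
   f: there are f_n (n < m) in the dual ball of N with f_n(2 e_n) = 1 and
   |sum_n t_n (f_n - f)| = O(sqrt m).  Hence, for finitely many x'' in X** with
   almost norming functionals f, some n < m gives x''(f_n) close to x''(f) for all
   of them at once, so that |x'' + 2 e_n| is almost |x''| + 1.  A finite net of
   the unit sphere of a finite-dimensional subspace does the rest. *)

(** * Hahn-Banach theorem for sublinear functionals *)

Section HahnBanach.
Variables (R : realType) (V : lmodType R) (p : V -> R).

(** A partial linear functional is encoded by its graph, so that extension is inclusion. For
    sublinear [p], single-valuedness follows from the domination. *)
Definition dominated_graph (G : set (V * R)) :=
  [/\ G (0, 0),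
    forall (a : R) (u v : V * R), G u -> G v ->
      G (a *: u.1 + v.1, a * u.2 + v.2) &
    forall u, G u -> u.2 <= p u.1].

Hypotheses (pD : forall x y, p (x + y) <= p x + p y)
  (pZ : forall (a : R) x, 0 < a -> p (a *: x) = a * p x).

(** A value at [v] is admissible when it lies between all u.2 - p (u.1 - v) and all p (u.1 + v) -
    u.2; the supremum [c] of the former does. *)
Lemma dominated_graph_extend (G : set (V * R)) (v : V) :
  dominated_graph G ->
  exists H, [/\ dominated_graph H, G `<=` H & exists r, H (v, r)].
Proof.
move=> [G0 GL Gp].
pose L := [set u.2 - p (u.1 - v) | u in G].
have GD u w : G u -> G w -> u.2 + w.2 <= p (u.1 - v) + p (w.1 + v).
  move=> Gu Gw; have := Gp _ (GL 1 u w Gu Gw); rewrite /= scale1r mul1r.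
  by move/le_trans; apply; apply: le_trans (pD _ _); rewrite addrACA addNr addr0.
have L0 : L !=set0 by exists (0 - p (0 - v)), (0, 0).
have Lub : has_ubound L.
  exists (p (0 + v)) => _ [u Gu <-]; rewrite lerBlDl.
  by have /= := GD u (0, 0) Gu G0; rewrite addr0.
pose c := sup L.
have cge u : G u -> u.2 - p (u.1 - v) <= c.
  by move=> Gu; apply: ub_le_sup => //; exists u.
have cle u : G u -> c <= p (u.1 + v) - u.2.
  move=> Gu; apply: ge_sup => // _ [w Gw <-].
  by rewrite lerBrDr addrAC lerBlDr addrC [leRHS]addrC addrC; exact: GD.
pose H := [set u : V * R | exists a w, G w /\ u = (w.1 + a *: v, w.2 + a * c)].
exists H; split.
- split.
  + by exists 0, (0, 0); split => //=; rewrite scale0r mul0r !addr0.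
  + move=> a _ _ [b [u [Gu ->]]] [d [w [Gw ->]]] /=.
    exists (a * b + d), (a *: u.1 + w.1, a * u.2 + w.2); split; first exact: GL.
    rewrite /= !mulrDl !mulrDr scalerDr scalerDl scalerA mulrA.
    by rewrite (addrACA (a *: u.1)) (addrACA (a * u.2)).
  + move=> _ [a [w [Gw ->]]] /=.
    have Gs b : G (b *: w.1, b * w.2).
      by have /= := GL b w (0, 0) Gw G0; rewrite !addr0.
    (* After division by |a|, the cases a > 0 and a < 0 are [cle] and [cge]. *)
    have [a0|a0|->] := ltrgt0P a.
    * have := cle _ (Gs a^-1); rewrite /= -(ler_pM2l a0) mulrBr -pZ//.
      rewrite scalerDr scalerA mulrA mulfV ?gt_eqF// scale1r mul1r.
      by rewrite lerBrDr addrC.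
    * have na0 : 0 < - a by rewrite oppr_gt0.
      have := cge _ (Gs (- a)^-1); rewrite /= -(ler_pM2l na0) mulrBr -pZ//.
      rewrite scalerBr scalerA mulrA mulfV ?gt_eqF// scale1r mul1r.
      by rewrite scaleNr opprK mulNr lerBlDr addrC -lerBlDr opprK.
    * by rewrite scale0r mul0r !addr0; exact: Gp.
- by move=> u Gu; exists 0, u; split => //; rewrite scale0r mul0r !addr0; case: u Gu.
- by exists c, 1, (0, 0); split => //=; rewrite scale1r mul1r !add0r.
Qed.

Lemma Hahn_Banach (G : set (V * R)) : dominated_graph G ->
  exists F : {linear V -> R^o},
    (forall v, F v <= p v) /\ forall v r, G (v, r) -> F v = r.
Proof.
move=> gG.
(* The union with [G] makes [P] hold for the union of the empty chain too. *)
pose P : set (set (V * R)) := [set A | dominated_graph (G `|` A)].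
have [F FP totF|A [PA maxA]] := @Zorn_bigcup _ P.
  have [[A0 FA0]|F0] := pselect (F !=set0); last first.
    suff -> : \bigcup_(X in F) X = set0 by rewrite /P /= setU0.
    by apply/seteqP; split => // u [A FA _]; apply: F0; exists A.
  have both u w : (G `|` \bigcup_(X in F) X) u -> (G `|` \bigcup_(X in F) X) w ->
      exists A, [/\ F A, (G `|` A) u & (G `|` A) w].
    move=> [Gu|[A FA Au]] [Gw|[B FB Bw]].
    - by exists A0; split => //; left.
    - by exists B; split => //; [left|right].
    - by exists A; split => //; [right|left].
    - have [AB|BA] := totF _ _ FA FB.
      + by exists B; split => //; right => //; exact: AB.
      + by exists A; split => //; right => //; exact: BA.
  split; first by left; case: gG.
  - move=> a u w /both /[apply] -[A [FA Au Aw]].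
    have [_ /(_ a _ _ Au Aw) + _] := FP _ FA.
    by move=> [?|?]; [left|right; exists A].
  - by move=> u /[dup] /both /[apply] -[A [FA Au _]]; have [_ _] := FP _ FA; exact.
set M := G `|` A in PA.
have [M0 ML Mp] : dominated_graph M by [].
have Mtot v : exists r, M (v, r).
  have [H [gH MH [r Hvr]]] := dominated_graph_extend M v PA.
  apply: contrapT => nM; apply: (maxA H).
    split; first by move=> u Au; apply: MH; right.
    by move=> HA; apply: nM; exists r; right; exact: HA.
  suff -> : P H = dominated_graph H by [].
  by rewrite /P /= (_ : G `|` H = H)//; apply/setUidr => u Gu; apply: MH; left.
have /choice[f Mf] := Mtot.
(* The difference of two values at one vector is a value at 0, hence at most [p 0] = 0. *)
have Muniq v r s : M (v, r) -> M (v, s) -> r = s.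
  have le r' s' : M (v, r') -> M (v, s') -> r' <= s'.
    move=> Mr Ms; have := Mp _ (ML (-1) _ _ Ms Mr); rewrite /= scaleN1r addNr mulN1r.
    have -> : p 0 = 0.
      have := pZ (1 + 1) 0 (addr_gt0 ltr01 ltr01).
      by rewrite scaler0 mulrDl mul1r => /eqP; rewrite -subr_eq0 opprD addNKr oppr_eq0 => /eqP.
    by rewrite addrC subr_le0.
  by move=> Mr Ms; apply/eqP; rewrite eq_le !le.
have flin : linear (f : V -> R^o).
  by move=> a u v; apply: (Muniq (a *: u + v)) => //; exact: (ML a _ _ (Mf u) (Mf v)).
pose FL := GRing.isLinear.Build R V R^o *:%R (f : V -> R^o) flin.
pose F : {linear V -> R^o} := HB.pack (f : V -> R^o) FL.
exists F; split=> [v|v r Gvr]; first exact: (Mp _ (Mf v)).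
by apply: (Muniq v) => //; left.
Qed.

End HahnBanach.

(** * Finite nets in finite-dimensional subspaces *)

Section FiniteNet.
Variables (R : realType) (V : normedModType R).

Definition lincomb n (v : 'I_n -> V) (a : 'rV[R]_n) : V := \sum_i a 0 i *: v i.

Lemma continuous_lincomb n (v : 'I_n -> V) : continuous (lincomb n v).
Proof.
apply: (@continuous_big _ _ +%R) => [|i _ a]; first exact: add_continuous.
exact: (@cvgZr_tmp _ _ _ (nbhs a) _ _ _ _ (@coord_continuous R 1 n 0 i a)).
Qed.

Definition box n (C : R) := [set a : 'rV[R]_n | forall i, `|a ord0 i| <= C].

Lemma compact_box n C : compact (box n C).
Proof.
rewrite (_ : box n C = [set a : 'rV[R]_n | forall i, [set` `[- C, C]] (a ord0 i)]).
  exact: (@rV_compact R n (fun=> [set` `[- C, C]]) (fun=> @segment_compact _ _ _)).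
by apply/seteqP; split=> a /= aC i; have := aC i; rewrite /= in_itv /= ler_norml.
Qed.

(** As the [v i] may be dependent, only some representation of each vector is bounded. Induction: a
    first vector in the span of the others gets coefficient 0; otherwise its distance to that span
    is positive and controls its coefficient. *)
Lemma bounded_coefficients n (v : 'I_n -> V) : exists2 C : R, 0 <= C &
  forall a, exists2 b, lincomb n v b = lincomb n v a & box n (C * `|lincomb n v a|) b.
Proof.
elim: n v => [v|n IH v].
  by exists 0 => // a; exists a => // -[].
pose v' i := v (lift ord0 i); pose w := v ord0.
have lcS (c : R) (a : 'rV_n) : lincomb n.+1 v (row_mx (c%:M : 'rV_1) a) = c *: w + lincomb n v' a.
  rewrite /lincomb big_ord_recl; congr (_ *: _ + _).
    transitivity (row_mx (c%:M : 'rV_1) a 0 (lshift n ord0)); last first.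
      by rewrite row_mxEl mxE eqxx mulr1n.
    by congr (row_mx _ _ _ _); exact/val_inj.
  apply: eq_bigr => i _; congr (_ *: _).
  rewrite -[RHS](row_mxEr (c%:M : 'rV_1)).
  by congr (row_mx _ _ _ _); exact/val_inj.
have lcE (a : 'rV[R]_n.+1) :
    lincomb n.+1 v a = a 0 ord0 *: w + lincomb n v' (\row_i a 0 (lift ord0 i)).
  rewrite /lincomb big_ord_recl; congr (_ + _).
  by apply: eq_bigr => i _; rewrite mxE.
have boxS (D c : R) a : `|c| <= D -> box n D a -> box (1 + n) D (row_mx (c%:M : 'rV_1) a).
  move=> cD aD i; case: (@split_ordP 1 n i) => j ->.
    by rewrite row_mxEl mxE (ord1 j) eqxx mulr1n.
  by rewrite row_mxEr.
have [C C0 HC] := IH v'.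
have [[a0 wE]|wW] := pselect (exists a, w = lincomb n v' a).
  exists C => // a.
  pose a' : 'rV[R]_n := a 0 ord0 *: a0 + \row_i a 0 (lift ord0 i).
  have a'E : lincomb n v' a' = lincomb n.+1 v a.
    rewrite lcE wE /lincomb scaler_sumr -big_split; apply: eq_bigr => i _ /=.
    by rewrite !mxE scalerDl scalerA.
  have [b bE bC] := HC a'; exists (row_mx (0%:M : 'rV_1) b).
    by rewrite lcS scale0r add0r bE.
  apply: boxS; first by rewrite normr0 mulr_ge0.
  by rewrite -a'E.
(* Combinations of norm above |w| + 1 give a norm of at least 1; the others have coefficients in the
   compact [K], where a nonzero minimum is attained. *)
have [d d0 Hd] : exists2 d, 0 < d & forall a, d <= `|w + lincomb n v' a|.
  pose K := box n (C * (`|w| + 1)).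
  have K0 : K !=set0 by exists 0 => i; rewrite mxE normr0 mulr_ge0// addr_ge0.
  have cK : continuous (fun a => `|w + lincomb n v' a|).
    move=> a; apply: (@cvg_norm _ _ _ (nbhs a)).
    exact: (@cvgD _ _ _ (nbhs a) _ _ _ _ _ (cvg_cst w) (continuous_lincomb n v' a)).
  have [c _ cmin] := EVT_min_rV K0 (compact_box n _) (continuous_subspaceT cK).
  exists (Num.min 1 `|w + lincomb n v' c|).
    rewrite lt_min ltr01 /= normr_gt0; apply/eqP => w0; apply: wW; exists (- c).
    move/eqP: w0; rewrite addr_eq0 => /eqP ->; rewrite /lincomb -sumrN.
    by apply: eq_bigr => i _; rewrite mxE scaleNr.
  move=> a; rewrite ge_min.
  have [le|lt] := leP `|lincomb n v' a| (`|w| + 1).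
    have [b bE bC] := HC a; apply/orP; right; rewrite -bE; apply: cmin.
    by rewrite inE /K => i; apply: (le_trans (bC i)); rewrite ler_wpM2l.
  apply/orP; left.
  rewrite addrC; apply: le_trans (lerB_normD _ _).
  by rewrite lerBrDr addrC ltW.
(* The coefficient of [w] costs a factor 1 / d; what remains has norm at most 1 + |w| / d times that
   of the vector. *)
pose D := Num.max d^-1 (C * (1 + d^-1 * `|w|)).
exists D; first by rewrite le_max invr_ge0 ltW.
move=> a; set c := a 0 ord0; set a' : 'rV[R]_n := \row_i a 0 (lift ord0 i).
have cle : `|c| <= d^-1 * `|lincomb n.+1 v a|.
  rewrite mulrC ler_pdivlMr// lcE -/c -/a'.
  have [->|c0] := eqVneq c 0; first by rewrite normr0 mul0r.
  have -> : c *: w + lincomb n v' a' = c *: (w + lincomb n v' (c^-1 *: a')).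
    rewrite scalerDr; congr (_ + _); rewrite /lincomb scaler_sumr.
    by apply: eq_bigr => i _; rewrite !mxE scalerA mulrA mulfV// mul1r.
  by rewrite normrZ ler_wpM2l.
have [b bE bC] := HC a'; exists (row_mx (c%:M : 'rV_1) b).
  by rewrite lcS bE lcE.
apply: boxS.
  by apply: (le_trans cle); rewrite ler_wpM2r// le_max lexx.
move=> i; apply: (le_trans (bC i)).
apply: (@le_trans _ _ (C * (1 + d^-1 * `|w|) * `|lincomb n.+1 v a|)); last first.
  by rewrite ler_wpM2r// le_max lexx orbT.
rewrite -mulrA ler_wpM2l// mulrDl mul1r.
have -> : lincomb n v' a' = lincomb n.+1 v a - c *: w by rewrite lcE addrC addKr.
apply: (le_trans (ler_normB _ _)); rewrite lerD2l normrZ mulrAC.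
by rewrite ler_wpM2r.
Qed.

(** The unit ball of [E] lies in the continuous image of a compact box, which finitely many
    preimages of [d]-balls cover. *)
Lemma finite_net (E : set V) (d : R) : finite_dimensional_subspace E -> 0 < d ->
  exists s : seq V, forall x, E x -> `|x| <= 1 -> exists2 u, u \in s & `|x - u| < d.
Proof.
move=> [n [v ->]] d0.
have [C C0 HC] := bounded_coefficients n v.
have := compact_box n C; rewrite compact_cover => /(_ _ setT
  (fun b => lincomb n v @^-1` [set z | `|z - lincomb n v b| < d])).
case=> [b _|b _|D _ Dcov].
- apply: open_comp => [a _|]; first exact: continuous_lincomb.
  rewrite (_ : [set z | _] = ball (lincomb n v b) d); first exact: ball_open.
  by rewrite -ball_normE; apply/seteqP; split => z /=; rewrite distrC.
- by exists b => //=; rewrite subrr normr0.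
exists [seq lincomb n v b | b <- enum_fset D] => x [a _ ax] x1.
have [b bE bC] := HC (\row_i a i).
have lE : lincomb n v (\row_i a i) = x.
  by rewrite -ax; apply: eq_bigr => i _; rewrite mxE.
have [|c cD] := Dcov b.
  by move=> i; apply: (le_trans (bC i)); rewrite lE ler_piMr.
by rewrite /= bE lE => xc; exists (lincomb n v c) => //; apply: map_f.
Qed.

End FiniteNet.

(** * Elementary facts on dual norms *)

Section Dual.
Variables (R : realType) (X : normedModType R).

Lemma dualZ (f : dual X) (a : R) x : f (a *: x) = a * f x.
Proof. exact: linearZ. Qed.

Lemma dual_le (f : dual X) x : `|f x| <= `|f| * `|x|.
Proof.
have [->|x0] := eqVneq x 0; first by rewrite linear0 !normr0 mulr0.
have nx : 0 < `|x| by rewrite normr_gt0.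
have := @dual_norm_ub R X f (`|x|^-1 *: x).
rewrite normrZ normfV normr_id mulVf ?gt_eqF// => /(_ (lexx _)).
by rewrite linearZ /= normrM normfV normr_id mulrC ler_pdivrMr.
Qed.

Lemma dual_normP (f : dual X) M : 0 <= M ->
  (forall x, `|f x| <= M * `|x|) -> `|f| <= M.
Proof.
by move=> M0 fM; apply: dual_norm_le => x x1; apply: (le_trans (fM x)); rewrite ler_piMr.
Qed.

Lemma dual_exists (f : {linear X -> R^o}) M :
  (forall x, `|f x| <= M * `|x|) -> exists g : dual X, forall x, g x = f x.
Proof.
move=> fM; suff fP : (f : X -> R^o) \in @dual_pred R X by exists (Dual fP).
rewrite inE; split; first exact: linearP.
apply/linear_bounded_continuous/bounded_funP => r; exists (`|M| * r) => x xr.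
apply: (le_trans (fM x)); apply: (le_trans (ler_norm _)).
by rewrite normrM normr_id ler_wpM2l.
Qed.

Lemma dual_norming (f : dual X) (d : R) : 0 < d ->
  exists2 x, `|x| <= 1 & `|f| - d <= f x.
Proof.
move=> d0; have [_ [x x1 <-] /ltW lt] := sup_adherent d0 (dual_norm_has_sup f).
have [f0|f0] := lerP 0 (f x); first by exists x => //; rewrite -[f x]ger0_norm.
by exists (- x); rewrite ?normrN// linearN -[- f x]ltr0_norm.
Qed.

End Dual.

(** * Octahedrality of the bidual from perturbations of functionals *)

Section OctahedralBidual.
Variables (R : realType) (Z : normedModType R).

Lemma octahedral_finite (V : normedModType R) :
  (forall (s : seq V) (d : R), 0 < d -> exists y : V, `|y| = 1 /\
    forall u, u \in s -> `|u| + 1 - d <= `|u + y|) -> octahedral V.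
Proof.
move=> H E e fE e0.
have d0 : 0 < e / 3 by rewrite divr_gt0.
have [s sE] := finite_net R V E (e / 3) fE d0.
have [y [y1 yH]] := H s (e / 3) d0; exists y; split => // x Ex.
have [->|x0] := eqVneq x 0.
  by rewrite normr0 !add0r y1 mulr1 lerBlDr lerDl ltW.
have nx : 0 < `|x| by rewrite normr_gt0.
set a := `|x| in nx *; pose z := a^-1 *: x.
have z1 : `|z| = 1 by rewrite normrZ normfV normr_id mulVf ?gt_eqF.
have xE : x = a *: z by rewrite scalerA mulfV ?gt_eqF// scale1r.
have Ez : E z.
  have [n [v EE]] := fE; move: Ex; rewrite EE => -[b _ bx].
  exists (fun i => a^-1 * b i) => //; rewrite /z -bx scaler_sumr.
  by apply: eq_bigr => i _; rewrite scalerA.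
(* A loss of e / 3 comes from each of: the estimate for [u], |u| against 1, and u + y against z +
   y. *)
have z2 : 2 - e <= `|z + y|.
  have [|u us zu] := sE _ Ez; first by rewrite z1.
  have := yH _ us; have := ler_distD u z 0; rewrite !subr0 z1.
  have := ler_normD (z + y) (u - z); rewrite addrC addrA subrK.
  rewrite (distrC u z) => h1 h2 h3; lra.
rewrite y1 xE.
(* For a >= 1 the vector a z + y is compared with a (z + y), for a < 1 with z + y. *)
have [a1|a1] := lerP 1 a.
  have : `|a *: (z + y)| <= `|a *: z + y| + `|(a - 1) *: y|.
    apply: le_trans (ler_normD _ _).
    by rewrite scalerDr scalerBl scale1r -addrA [y + _]addrC subrK.
  rewrite !normrZ y1 (gtr0_norm nx) ger0_norm ?subr_ge0//; nra.
have : `|z + y| <= `|a *: z + y| + `|(1 - a) *: z|.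
  apply: le_trans (ler_normD _ _).
  by rewrite scalerBl scale1r addrAC [_ *: z + _]addrC subrK.
rewrite normrZ z1 gtr0_norm ?subr_gt0//; nra.
Qed.

Lemma bidual_eval (z : Z) : exists y : dual (dual Z), forall f, y f = f z.
Proof.
have evL : linear (fun f : dual Z => f z : R^o) by [].
pose EL := GRing.isLinear.Build R (dual Z) R^o *:%R _ evL.
pose ev : {linear dual Z -> R^o} := HB.pack (fun f : dual Z => f z : R^o) EL.
have [|y yE] := @dual_exists R (dual Z) ev `|z|; last by exists y.
by move=> f; rewrite mulrC; exact: dual_le.
Qed.

Variable C : R.
Hypothesis perturb : forall r : nat, (0 < r)%N ->
  exists y : 'I_(r ^ 2) -> Z, (forall n, `|y n| <= 1) /\
    forall f : dual Z, `|f| <= 1 -> exists g : 'I_(r ^ 2) -> dual Z,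
      [/\ forall n, `|g n| <= 1, forall n, g n (y n) = 1 &
        forall t : 'I_(r ^ 2) -> R, (forall n, `|t n| <= 1) ->
          `|\sum_n t n *: (g n - f)| <= C * r%:R].

(** Suitable signs in [perturb] bound the sum over n of |u (g n - f)| by |u| C r. Over r^2 indices
    the mean is O(1 / r), so for large [r] one [n] serves finitely many [u], and evaluation at [y n]
    is the vector sought. *)
Lemma perturb_octahedral_bidual : octahedral (dual (dual Z)).
Proof.
apply: octahedral_finite => s d d0.
have d2 : 0 < d / 2 by rewrite divr_gt0.
have /choice[F HF] : forall u : dual (dual Z), exists f : dual Z,
    `|f| <= 1 /\ `|u| - d / 2 <= u f.
  by move=> u; have [f f1 uf] := dual_norming R (dual Z) u _ d2; exists f.
pose S := \sum_(u <- s) `|u| * C.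
pose r := (Num.bound `|S / (d / 2)|).+1.
have rS : S <= r%:R * (d / 2).
  rewrite -ler_pdivrMr//; apply: (le_trans (ler_norm _)); apply: ltW.
  by apply: (lt_le_trans (archi_boundP (normr_ge0 _))); rewrite ler_nat.
have r0 : (0 < r)%N by [].
have [y [y1 Hy]] := perturb r r0.
have /choice[g Hg] : forall u, exists g : 'I_(r ^ 2) -> dual Z,
      [/\ forall n, `|g n| <= 1, forall n, g n (y n) = 1 &
        forall t : 'I_(r ^ 2) -> R, (forall n, `|t n| <= 1) ->
          `|\sum_n t n *: (g n - F u)| <= C * r%:R].
  by move=> u; apply: Hy; case: (HF u).
have sumg (u : dual (dual Z)) : \sum_n `|u (g u n - F u)| <= `|u| * (C * r%:R).
  have [_ _ Ht] := Hg u.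
  have -> : \sum_n `|u (g u n - F u)| =
      u (\sum_n Num.sg (u (g u n - F u)) *: (g u n - F u)).
    rewrite linear_sum; apply: eq_bigr => n _; rewrite linearZ /=.
    by rewrite [LHS]normrEsg.
  apply: (le_trans (ler_norm _)); apply: (le_trans (dual_le _ _ _ _)).
  rewrite ler_wpM2l//; apply: Ht => n.
  by rewrite normr_sg; case: (_ == 0).
(* If every [n] failed, the double sum would exceed r^2 d / 2; but it is at most S r, and S <= r d /
   2 by the choice of [r]. *)
have [n Hn] : exists n, \sum_(u <- s) `|u (g u n - F u)| <= d / 2.
  apply: contrapT => nH.
  have lt n : d / 2 < \sum_(u <- s) `|u (g u n - F u)|.
    by rewrite ltNge; apply/negP => le; apply: nH; exists n.
  have : \sum_(n < r ^ 2) (d / 2) < \sum_(n < r ^ 2) \sum_(u <- s) `|u (g u n - F u)|.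
    apply: ltr_sum => [|n _]; last exact: lt.
    have r2 : (0 < r ^ 2)%N by rewrite expn_gt0.
    by apply/hasP; exists (Ordinal r2); rewrite ?mem_index_enum.
  apply/negP; rewrite -leNgt exchange_big /=.
  rewrite sumr_const card_ord.
  have -> : d / 2 *+ (r ^ 2) = r%:R * (d / 2) * r%:R.
    by rewrite -[LHS]mulr_natr natrX expr2 mulrA [r%:R * _]mulrC.
  apply: (@le_trans _ _ (\sum_(u <- s) `|u| * (C * r%:R))).
    by apply: ler_sum => u _; exact: sumg.
  under eq_bigr do rewrite mulrA.
  by rewrite -mulr_suml ler_wpM2r.
have [v vE] := bidual_eval (y n).
exists v; split.
  apply/eqP; rewrite eq_le; apply/andP; split.
    apply: dual_normP => // f; rewrite vE mul1r; apply: (le_trans (dual_le _ _ _ _)).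
    by rewrite ler_piMr.
  (* Any [g u n] shows that [v] has norm at least 1; u = 0 is taken. *)
  have [g1 gy _] := Hg 0.
  have := dual_le _ _ v (g 0 n); rewrite vE gy normr1 => /le_trans; apply.
  by rewrite ler_piMr.
move=> u us; have [g1 gy _] := Hg u; have [f1 uf] := HF u.
have ule : `|u (g u n - F u)| <= d / 2.
  apply: le_trans Hn.
  by rewrite (big_rem u)//= lerDl sumr_ge0.
have : (u + v) (g u n) <= `|u + v|.
  apply: (le_trans (ler_norm _)); apply: (le_trans (dual_le _ _ _ _)).
  by rewrite ler_piMr.
apply: le_trans.
have -> : (u + v) (g u n) = u (g u n) + 1 by rewrite -(gy n) -vE.
have := ler_normlW (le_trans _ ule).
move: ule; rewrite linearB /= ler_norml => /andP[ule _].
lra.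
Qed.

End OctahedralBidual.

(** * Transfer of perturbations from a norming family to the dual ball *)

Section NormingFamily.
Variables (R : realType) (Z : normedModType R) (T : Type) (l : T -> dual Z) (t0 : T).
Hypotheses (l_le : forall t z, l t z <= `|z|)
  (l_norming : forall z b, (forall t, l t z <= b) -> `|z| <= b).
Variables (m : nat) (tau : 'I_m -> T -> T) (y : 'I_m -> Z) (K : R).
Hypotheses (K0 : 0 <= K) (l_tau : forall n t, l (tau n t) (y n) = 1)
  (tau_near : forall s : 'I_m -> R, (forall n, `|s n| <= 1) -> forall t z,
    \sum_n s n * (l (tau n t) z - l t z) <= K * `|z|).

(** The first factor will carry [f], coordinate n of the second the functional [g n]. *)
Let V : lmodType R := (Z * {ffun 'I_m -> Z})%type.

Let U (w : V) t : R := l t w.1 + \sum_n l (tau n t) (w.2 n).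
Let p (w : V) := sup [set U w t | t in setT].

Let U_ub w : has_ubound [set U w t | t in setT].
Proof.
exists (`|w.1| + \sum_n `|w.2 n|) => _ [t _ <-].
by apply: lerD => //; apply: ler_sum.
Qed.

Let U_le w t : U w t <= p w.
Proof. by apply: ub_le_sup => //; exists t. Qed.

Let p_le w b : (forall t, U w t <= b) -> p w <= b.
Proof. by move=> Ub; apply: ge_sup => [|_ [t _ <-]//]; exists (U w t0), t0. Qed.

Let pD w z : p (w + z) <= p w + p z.
Proof.
apply: p_le => t; apply: le_trans (lerD (U_le w t) (U_le z t)).
rewrite /U /= linearD addrACA lerD2l -big_split /= ler_sum// => n _.
by rewrite ffunE linearD.
Qed.

Let UZ a w t : U (a *: w) t = a * U w t.
Proof.
rewrite /U /= linearZ mulrDr mulr_sumr; congr (_ + _).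
by apply: eq_bigr => n _; rewrite ffunE linearZ.
Qed.

Let pZ (a : R) w : 0 < a -> p (a *: w) = a * p w.
Proof.
move=> a0; apply/eqP; rewrite eq_le; apply/andP; split.
  by apply: p_le => t; rewrite UZ ler_pM2l.
rewrite -ler_pdivlMl//; apply: p_le => t.
by rewrite ler_pdivlMl// -UZ.
Qed.

(** On the first factor [f] is dominated by [p]; its extension [F], restricted to coordinate n, is
    [g n]. As F <= p, linear inequalities between [l t] and the [l (tau n t)] that hold for all [t]
    pass to [f] and the [g n]. *)
Lemma perturb_norming (f : dual Z) : `|f| <= 1 -> exists g : 'I_m -> dual Z,
  [/\ forall n, `|g n| <= 1, forall n, g n (y n) = 1 &
    forall s : 'I_m -> R, (forall n, `|s n| <= 1) -> `|\sum_n s n *: (g n - f)| <= K].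
Proof.
move=> f1.
have fle z : f z <= `|z|.
  by apply: (le_trans (ler_norm _)); apply: (le_trans (dual_le _ _ _ _)); rewrite ler_piMl.
pose G := [set u : V * R | exists z, u = ((z, 0) : V, f z)].
have gG : dominated_graph R V p G.
  split.
  - by exists 0; rewrite linear0.
  - move=> a _ _ [u ->] [v ->]; exists (a *: u + v); rewrite linearP /=.
    by congr ((_, _), _); apply/ffunP => n; rewrite !ffunE scaler0 addr0.
  - move=> _ [z ->] /=; apply: (le_trans (fle z)); apply: l_norming => t.
    apply: le_trans (U_le _ t); rewrite /U /= big1 ?addr0// => n _.
    by rewrite ffunE linear0.
have [F [Fp FG]] := Hahn_Banach R V p pD pZ G gG.
pose D n z : V := (0, [ffun k => if k == n then z else 0]).
have UD n z t : U (D n z) t = l (tau n t) z.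
  rewrite /U /= linear0 add0r (bigD1 n)//= ffunE eqxx big1 ?addr0// => k kn.
  by rewrite ffunE (negbTE kn) linear0.
have DL n : linear (D n).
  move=> a u v; congr (_, _); first by rewrite /= scaler0 addr0.
  by apply/ffunP => k; rewrite !ffunE; case: eqP => // _; rewrite scaler0 addr0.
have gL n : linear (F \o D n : Z -> R^o).
  by move=> a u v /=; rewrite DL linearP.
have g_le n z : F (D n z) <= `|z|.
  by apply: (le_trans (Fp _)); apply: p_le => t; rewrite UD.
have gN n z : F (D n (- z)) = - F (D n z).
  have := gL n (-1) z 0; rewrite addr0 scaleN1r /= => ->.
  have -> : D n 0 = 0.
    by congr (_, _); apply/ffunP => k; rewrite !ffunE; case: eqP.
  by rewrite linear0 addr0 scaleN1r.
have g_abs n z : `|F (D n z)| <= 1 * `|z|.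
  by rewrite mul1r ler_norml g_le andbT lerNl -gN -[leRHS]normrN.
have /choice[g Hg] : forall n, exists g : dual Z, forall z, g z = F (D n z).
  move=> n.
  pose BL := GRing.isLinear.Build R Z R^o *:%R (F \o D n : Z -> R^o) (gL n).
  pose h : {linear Z -> R^o} := HB.pack (F \o D n : Z -> R^o) BL.
  exact: (@dual_exists R Z h 1 (g_abs n)).
exists g; split.
- by move=> n; apply: dual_normP => // z; rewrite Hg.
- move=> n; apply/eqP; rewrite eq_le Hg; apply/andP; split.
    by apply: (le_trans (Fp _)); apply: p_le => t; rewrite UD l_tau.
  rewrite -lerN2 -gN.
  by apply: (le_trans (Fp _)); apply: p_le => t; rewrite UD linearN /= l_tau.
- move=> s s1; pose h := \sum_n s n *: (g n - f).
  have sumE z k (e : 'I_k -> dual Z) : (\sum_n e n) z = \sum_n e n z.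
    by elim/big_ind2: _ => // a b c d <- <-.
  have hE z : h z = \sum_n s n * (g n z - f z).
    by rewrite sumE.
  have h_le z : h z <= K * `|z|.
    (* On this [w], [U] is the left side of [tau_near]. *)
    pose w : V := (- \sum_n s n *: z, [ffun n => s n *: z]).
    have -> : h z = F w.
      have -> : w = \sum_n s n *: D n z + ((- \sum_n s n *: z, 0) : V).
        congr (_, _); rewrite /= ?(raddf_sum fst) ?(raddf_sum snd) /=.
          by rewrite [X in _ = X + _]big1 ?add0r// => n _; rewrite scaler0.
        apply/ffunP => n; rewrite addr0 sum_ffunE ffunE (bigD1 n)//= !ffunE eqxx.
        by rewrite big1 ?addr0// => k kn; rewrite !ffunE eq_sym (negbTE kn) scaler0.
      rewrite linearD linear_sum /= (FG _ _ (ex_intro _ _ erefl)) hE.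
      rewrite linearN linear_sum -sumrN -big_split; apply: eq_bigr => n _ /=.
      by rewrite mulrBr Hg; congr (_ - _); rewrite linearZ.
    apply: (le_trans (Fp _)); apply: p_le => t.
    apply: le_trans (tau_near s s1 t z); rewrite /U /= linearN linear_sum -sumrN -big_split.
    by apply: ler_sum => n _ /=; rewrite ffunE !dualZ addrC mulrBr.
  apply: dual_normP => // z; rewrite ler_norml h_le andbT lerNl.
  by have := h_le (- z); rewrite linearN normrN.
Qed.

End NormingFamily.

(** * Product measures on sign vectors *)

Section ProductWeight.
Variables (R : realType) (L : nat) (q : 'I_L -> bool -> R).
Hypotheses (q_ge0 : forall i b, 0 <= q i b) (q_sum : forall i, \sum_b q i b = 1).

Definition weight (e : {ffun 'I_L -> bool}) := \prod_i q i (e i).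

Lemma weight_ge0 e : 0 <= weight e.
Proof. by apply: prodr_ge0 => i _. Qed.

(** Independence of the coordinates. The formulas for one and two coordinates put the factor 1 at
    the others. *)
Lemma sum_weight_prod (h : 'I_L -> bool -> R) :
  \sum_e weight e * \prod_i h i (e i) = \prod_i \sum_b q i b * h i b.
Proof. by rewrite bigA_distr_bigA; apply: eq_bigr => e _; rewrite -big_split. Qed.

Lemma sum_weight : \sum_e weight e = 1.
Proof.
transitivity (\sum_e weight e * \prod_(i < L) (fun=> 1) (e i)).
  by apply: eq_bigr => e _; rewrite big1 ?mulr1.
rewrite (sum_weight_prod (fun _ _ => 1)) big1// => i _.
by rewrite -[RHS](q_sum i); apply: eq_bigr => b _; rewrite mulr1.
Qed.

Lemma sum_weight_coord k (h : bool -> R) :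
  \sum_e weight e * h (e k) = \sum_b q k b * h b.
Proof.
pose H i b := if i == k then h b else 1.
transitivity (\sum_e weight e * \prod_i H i (e i)).
  apply: eq_bigr => e _; rewrite (bigD1 k)//= /H eqxx big1 ?mulr1// => i ik.
  by rewrite (negbTE ik).
rewrite sum_weight_prod (bigD1 k)//= /H eqxx [X in _ * X]big1 ?mulr1// => i ik.
by rewrite -[RHS](q_sum i); apply: eq_bigr => b _; rewrite (negbTE ik) mulr1.
Qed.

Lemma sum_weight_coord2 j k (f h : bool -> R) : j != k ->
  \sum_e weight e * (f (e j) * h (e k)) =
  (\sum_b q j b * f b) * \sum_b q k b * h b.
Proof.
move=> jk; pose H i b := if i == j then f b else if i == k then h b else 1.
have kj : (k == j) = false by rewrite eq_sym (negbTE jk).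
transitivity (\sum_e weight e * \prod_i H i (e i)).
  apply: eq_bigr => e _; rewrite (bigD1 j)//= (bigD1 k) ?kj//= /H !eqxx kj.
  by rewrite big1 ?mulr1// => i /andP[/negbTE -> /negbTE ->].
rewrite sum_weight_prod (bigD1 j)//= (bigD1 k) ?kj//= /H !eqxx kj.
rewrite [X in _ * (_ * X)]big1 ?mulr1// => i /andP[/negbTE ij /negbTE ik].
by rewrite -[RHS](q_sum i); apply: eq_bigr => b _; rewrite ij ik mulr1.
Qed.

(* The functions [e |-> psi i (e i)] are centred and independent, hence
   orthogonal in L^2(weight). *)
Lemma sum_weight_abs (psi : 'I_L -> bool -> R) (t : 'I_L -> R) (r : R) : 0 < r ->
  (forall i, \sum_b q i b * psi i b = 0) -> (forall i b, `|psi i b| <= 2) ->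
  \sum_i t i ^+ 2 <= r ^+ 2 ->
  \sum_e weight e * `|\sum_i t i * psi i (e i)| <= 2 * r.
Proof.
move=> r0 psi0 psi2 tr.
pose S e := \sum_i t i * psi i (e i).
(* Only the diagonal terms of the square survive, each at most 4 t_i^2. *)
have S2 : \sum_e weight e * S e ^+ 2 <= 4 * r ^+ 2.
  have -> : \sum_e weight e * S e ^+ 2 =
      \sum_i t i ^+ 2 * \sum_b q i b * psi i b ^+ 2.
    transitivity (\sum_e \sum_i \sum_j t i * t j * (weight e * (psi i (e i) * psi j (e j)))).
      apply: eq_bigr => e _; rewrite expr2 /S mulr_suml mulr_sumr.
      apply: eq_bigr => i _; rewrite mulr_sumr mulr_sumr; apply: eq_bigr => j _; ring.
    rewrite exchange_big; apply: eq_bigr => i _ /=.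
    rewrite exchange_big /= (bigD1 i)//= [X in _ + X]big1 ?addr0.
      rewrite -mulr_sumr -expr2; congr (_ * _).
      by rewrite -sum_weight_coord; apply: eq_bigr => e _; rewrite expr2.
    move=> j ji; rewrite -mulr_sumr sum_weight_coord2 1?eq_sym//.
    by rewrite psi0 mul0r mulr0.
  apply: (@le_trans _ _ (4 * \sum_i t i ^+ 2)); last by rewrite ler_pM2l.
  rewrite mulr_sumr; apply: ler_sum => i _; rewrite mulrC ler_wpM2r ?sqr_ge0//.
  have -> : 4 = \sum_b q i b * 4 by rewrite -mulr_suml q_sum mul1r.
  apply: ler_sum => b _; rewrite ler_wpM2l// -real_normK ?num_real//.
  by have := psi2 i b; have := normr_ge0 (psi i b); nra.
(* AM-GM: |S| <= S^2 / (4 r) + r *)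
have absS x : `|x| <= x ^+ 2 / (4 * r) + r.
  rewrite -(ler_pM2l (_ : 0 < 4 * r)) ?mulr_gt0// mulrDr mulrCA mulfV ?mulr1; last first.
    by rewrite gt_eqF ?mulr_gt0.
  rewrite -[x ^+ 2]real_normK ?num_real//; have := sqr_ge0 (`|x| - 2 * r); nra.
apply: (@le_trans _ _ (\sum_e weight e * (S e ^+ 2 / (4 * r) + r))).
  by apply: ler_sum => e _; rewrite ler_wpM2l// weight_ge0.
under eq_bigr do rewrite mulrDr mulrA.
rewrite big_split /= -!mulr_suml sum_weight mul1r (mulr_natl r 2) mulr2n lerD2r.
rewrite ler_pdivrMr ?mulr_gt0//; apply: (le_trans S2); lra.
Qed.

End ProductWeight.

(** * Averages over biased signs *)

Section BiasedAverage.
Variable R : realType.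

Definition sgnb (b : bool) : R := if b then 1 else - 1.

(** The probability of the sign [b] at [i] when the mean is [a i]. *)
Definition bias (a : nat -> R) (L : nat) (i : 'I_L) (b : bool) : R :=
  (1 + a i * sgnb b) / 2.

Definition biased_average (a : nat -> R) (L : nat) (k : {ffun 'I_L -> bool} -> R) :=
  \sum_e weight R L (bias a L) e * k e.

(** The bound 1/2 keeps every [bias] at least 1/4, so that changing one mean changes the density by
    a bounded factor. *)
Definition half_box (a : nat -> R) := forall i, `|a i| <= 2^-1.

Definition update (a : nat -> R) (n : nat) (c : R) := fun i => if i == n then c else a i.

Lemma half_box_update a n c : half_box a -> `|c| <= 2^-1 -> half_box (update a n c).
Proof. by move=> ha hc i; rewrite /update; case: eqP. Qed.

Lemma bias_gt0 a L i b : half_box a -> 0 < bias a L i b.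
Proof.
by move=> /(_ i); rewrite /bias ler_norml => /andP[? ?]; case: b; rewrite /sgnb; lra.
Qed.

Lemma bias_sum a L i : \sum_b bias a L i b = 1.
Proof. by rewrite big_bool /bias /sgnb /=; field. Qed.

Lemma biased_average_coord a L i :
  half_box a -> biased_average a L (fun e => sgnb (e i)) = a i.
Proof.
move=> ha; rewrite /biased_average sum_weight_coord; last exact: bias_sum.
by rewrite big_bool /bias /sgnb /=; field.
Qed.

Lemma biased_average_le a L k M : half_box a -> (forall e, `|k e| <= M) ->
  `|biased_average a L k| <= M.
Proof.
move=> ha kM; apply: (le_trans (ler_norm_sum _ _ _)).
rewrite -[leRHS]mul1r -(sum_weight R L _ (bias_sum a L)) mulr_suml.
apply: ler_sum => e _.
have w0 : 0 <= weight R L (bias a L) e.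
  by apply: weight_ge0 => i b; exact/ltW/bias_gt0.
by rewrite normrM ger0_norm// ler_wpM2l.
Qed.

(** The sum is the integral of [k] against a combination of the orthogonal functions [psi n], whose
    L^1 norm is at most 2 r. *)
Lemma biased_average_update (a c t : nat -> R) L r (k : {ffun 'I_L -> bool} -> R) M :
  half_box a -> half_box c -> (forall n, `|t n| <= 1) -> (0 < r)%N -> (r ^ 2 <= L)%N -> (forall e, `|k e| <= M) ->
  `|\sum_(n < r ^ 2) t n *
     (biased_average (update a n (c n)) L k - biased_average a L k)| <= 2 * M * r%:R.
Proof.
move=> ha hc t1 r0 rL kM.
(* The ratio of the new bias to the old one, minus 1. The numerator is at most 1 in absolute value
   and the denominator at least 1/2, whence the bound 2. *)
pose psi n b := (c n - a n) * sgnb b / (1 + a n * sgnb b).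
have den n b : 2^-1 <= 1 + a n * sgnb b.
  by have := ha n; rewrite ler_norml => /andP[? ?]; case: b; rewrite /sgnb; lra.
have den0 n b : 0 < 1 + a n * sgnb b by apply: lt_le_trans (den n b); rewrite invr_gt0.
have w0 e : 0 <= weight R L (bias a L) e.
  by apply: weight_ge0 => i b; exact/ltW/bias_gt0.
have wE (i : 'I_L) e : weight R L (bias (update a i (c i)) L) e =
    weight R L (bias a L) e * (1 + psi i (e i)).
  rewrite /weight (bigD1 i)//= [in RHS](bigD1 i)//= [RHS]mulrAC; congr (_ * _).
    rewrite /bias /update eqxx /psi; field.
    by rewrite gt_eqF.
  apply: eq_bigr => j ji; rewrite /bias /update.
  by rewrite (negbTE (_ : nat_of_ord j != i)).
have dE (i : 'I_L) : biased_average (update a i (c i)) L k - biased_average a L k =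
    \sum_e weight R L (bias a L) e * psi i (e i) * k e.
  rewrite -sumrB; apply: eq_bigr => e _; rewrite wE; ring.
rewrite (big_ord_widen L (fun n => t n *
  (biased_average (update a n (c n)) L k - biased_average a L k)))//.
(* Extending by 0 to all [L] coordinates keeps the sum of squares at most r^2. *)
pose s (i : 'I_L) := if (i < r ^ 2)%N then t i else 0.
have -> : \sum_(i < L | (i < r ^ 2)%N)
     t i * (biased_average (update a i (c i)) L k - biased_average a L k) =
    \sum_e weight R L (bias a L) e * (\sum_i s i * psi i (e i)) * k e.
  rewrite big_mkcond /=.
  under [RHS]eq_bigr do rewrite mulr_sumr mulr_suml.
  rewrite exchange_big /=; apply: eq_bigr => i _; rewrite /s.
  case: ifP => _; last by rewrite big1// => e _; rewrite mul0r mulr0 mul0r.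
  rewrite dE mulr_sumr; apply: eq_bigr => e _; ring.
apply: (le_trans (ler_norm_sum _ _ _)).
have M0 : 0 <= M by apply: le_trans (kM [ffun=> true]).
apply: (@le_trans _ _ (\sum_e weight R L (bias a L) e * `|\sum_i s i * psi i (e i)| * M)).
  apply: ler_sum => e _; rewrite !normrM (ger0_norm (w0 e)) ler_wpM2l//.
  by rewrite mulr_ge0.
rewrite -mulr_suml mulrAC ler_wpM2r//.
apply: (sum_weight_abs R L (bias a L) _ _ (fun i b => psi i b)).
- by move=> i b; exact/ltW/bias_gt0.
- exact: bias_sum.
- by rewrite ltr0n.
- move=> i; rewrite big_bool /bias /psi /sgnb /= !mulr1 !mulrN1.
  have := den0 i true; have := den0 i false; rewrite /sgnb /= mulr1 mulrN1 => ? ?.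
  by field; rewrite !gt_eqF.
- move=> i b; rewrite /psi normrM normfV (gtr0_norm (den0 i b)) ler_pdivrMr//.
  have -> : `|(c i - a i) * sgnb b| = `|c i - a i|.
    by case: b; rewrite /sgnb ?mulr1// mulrN1 normrN.
  have := den i b; have := ler_normB (c i) (a i); have := ha i; have := hc i.
  lra.
- apply: (@le_trans _ _ (\sum_(i < L | (i < r ^ 2)%N) 1)).
    rewrite [leRHS]big_mkcond; apply: ler_sum => i _; rewrite /s.
    by case: ifP => _; rewrite ?expr0n// -real_normK ?num_real// expr_le1.
  by rewrite -(big_ord_widen L (fun=> 1))// sumr_const card_ord natrX.
Qed.

End BiasedAverage.

(** * Limits along an ultrafilter *)

Section UltraLimit.
Variables (R : realType) (T : Type) (U : set_system T).
Context {UU : UltraFilter U}.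

(** By compactness there is a cluster point, and for an ultrafilter a cluster point is a limit. *)
Lemma ultra_bounded_cvg (u : T -> R) (M : R) : (forall n, `|u n| <= M) ->
  exists l : R, u @ U --> l.
Proof.
move=> uM.
have [|l [_ Ul]] := @segment_compact R (- M) M (u @ U) _.
  by apply: (@filterE _ U) => n; rewrite /= in_itv /= -ler_norml.
exists l => A Al; have [//|nA] := in_ultra_setVsetC (u @^-1` A) UU.
by have [x [nAx Ax]] := Ul (~` A) A nA Al.
Qed.

End UltraLimit.

(** * The functionals [g a] as limits of averages *)

Section BiasedFunctionals.
Variables (R : realType) (X : normedModType R) (B : R) (e : nat -> X).
Variable k : forall L, {ffun 'I_L -> bool} -> dual X.
Hypotheses (k_le : forall L s x, `|k L s x| <= B * `|x|)
  (k_e : forall L s (i : 'I_L), k L s (e i) = sgnb R (s i)).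

(** One ultrafilter finer than [\oo] serves all [a] and [x], so the limits are linear in [x] and
    estimates on several [g a] together pass to the limit. *)
Lemma biased_functionals : exists g : (nat -> R) -> dual X,
  forall a, half_box R a ->
  [/\ forall x, `|g a x| <= B * `|x|, forall n, g a (e n) = a n &
    forall (c t : nat -> R) r x, half_box R c -> (forall n, `|t n| <= 1) -> (0 < r)%N ->
      `|\sum_(n < r ^ 2) t n * (g (update R a n (c n)) x - g a x)|
        <= 2 * (B * `|x|) * r%:R].
Proof.
have [U [UU ooU]] := @ultraFilterLemma nat \oo _.
pose S a x L := biased_average R a L (fun s => k L s x).
have S_le a x L : half_box R a -> `|S a x L| <= B * `|x|.
  by move=> ha; exact: biased_average_le.
have S_lin a c x y L : S a (c *: x + y) L = c * S a x L + S a y L.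
  rewrite /S /biased_average mulr_sumr -big_split; apply: eq_bigr => s _ /=.
  by rewrite linearD /= dualZ mulrDr mulrCA.
have le_lim (u : nat -> R) l M : u @ U --> l -> (\forall L \near \oo, `|u L| <= M) -> `|l| <= M.
  by move=> ul uM; apply: (cvgr_to_le (cvg_norm ul)); exact: ooU.
have lim_ex a : exists g : dual X, half_box R a -> forall x, S a x @ U --> (g x : R).
  (* Outside the half box the functional is set to 0. *)
  have [ha|nha] := pselect (half_box R a); last by exists 0.
  have /choice[f fl] : forall x, exists l : R, S a x @ U --> l.
    by move=> x; apply: (@ultra_bounded_cvg _ _ _ UU _ (B * `|x|)) => L; exact: S_le.
  have flin : linear (f : X -> R^o).
    move=> c x y.
    have fD : S a (c *: x + y) @ U --> c * f x + f y.
      rewrite (_ : S a _ = fun L => c * S a x L + S a y L); last exact/funext.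
      by apply: cvgD (fl y); apply: cvgMl_tmp (fl x).
    exact: (cvg_unique (@norm_hausdorff _ _) (fl _) fD).
  pose FL := GRing.isLinear.Build R X R^o *:%R (f : X -> R^o) flin.
  pose F : {linear X -> R^o} := HB.pack (f : X -> R^o) FL.
  have [|g gE] := @dual_exists R X F B.
    move=> x; apply: (le_lim _ _ _ (fl x)); apply: nearW => L; exact: S_le.
  by exists g => _ x; rewrite gE.
have /choice[g gl] := lim_ex.
exists g => a ha; split => [x|n|c t r x hc t1 r0].
- by apply: (le_lim (S a x)); [exact: gl|near=> L; exact: S_le].
- apply: (cvg_unique (@norm_hausdorff _ _) (gl a ha (e n))).
  (* As soon as L > n, the average at [e n] is exactly [a n]. *)
  apply: cvg_near_cst; apply: ooU; near=> L.
  have nL : (n < L)%N by near: L; exact: nbhs_infty_gt.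
  rewrite /S -[RHS](biased_average_coord R a L (Ordinal nL) ha).
  by congr (biased_average _ _ _ _); apply/funext => s; rewrite -k_e.
apply: (le_lim (fun L => \sum_(n < r ^ 2) t n * (S (update R a n (c n)) x L - S a x L))).
  apply: (@cvg_big _ _ +%R) => [|i _]; first exact: add_continuous.
  apply: cvgMl_tmp; apply: cvgB; apply: gl => //.
  exact: half_box_update.
near=> L; apply: biased_average_update => //.
near: L; exact: nbhs_infty_ge.
Unshelve. all: by end_near.
Qed.

End BiasedFunctionals.

(** * The unit vectors of l1 *)

Section L1Basis.
Variable R : realType.

Lemma sum_le_l1_norm (u : l1 R) L : \sum_(i < L) `|u i| <= `|u|.
Proof.
apply: (@le_trans _ _ ([normed series u] L)).
  by rewrite -(big_mkord xpredT (fun i => `|u i|)).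
have := @l1_cvg R u; set v := [normed series u] => cv.
apply: (@nondecreasing_cvgn_le R v _ cv).
apply/nondecreasing_seqP => m.
change (\sum_(0 <= k < m) `|u k| <= \sum_(0 <= k < m.+1) `|u k|).
by rewrite big_nat_recr//= lerDl.
Qed.

Lemma l1_basis n : exists d : l1 R, forall i, d i = (i == n)%:R.
Proof.
suff dP : (fun i => (i == n)%:R) \in @l1_pred R by exists (L1 dP).
rewrite inE /=; apply/cvg_ex; exists 1; apply: cvg_near_cst; near=> m.
have nm : (n < m)%N by near: m; exact: nbhs_infty_gt.
transitivity (\sum_(i < m) `|(i == n :> nat)%:R : R|).
  by rewrite -(big_mkord xpredT (fun i => `|(i == n)%:R : R|)).
rewrite (bigD1 (Ordinal nm))//= eqxx normr1 big1 ?addr0//.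
by move=> i im; rewrite (negbTE (_ : nat_of_ord i != n)) ?normr0.
Unshelve. all: by end_near. Qed.

Lemma l1_basis_norm n (d : l1 R) : (forall i, d i = (i == n)%:R) -> `|d| <= 1.
Proof.
move=> dE; have -> : `|d| = limn [normed series d] by [].
apply: limr_le; first exact: (@l1_cvg R d).
apply: nearW => m; have -> : [normed series d] m = \sum_(i < m) `|d i|.
  by rewrite -(big_mkord xpredT (fun i => `|d i|)).
have [nm|mn] := ltnP n m.
  rewrite (bigD1 (Ordinal nm))//= dE eqxx normr1 big1 ?addr0//.
  by move=> i im; rewrite dE (negbTE (_ : nat_of_ord i != n)) ?normr0.
rewrite big1// => i _; rewrite dE (_ : (i == n :> nat) = false) ?normr0//.
by apply/eqP => im; have := leq_trans (ltn_ord i) mn; rewrite im ltnn.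
Qed.

End L1Basis.

(** * Sign functionals on a copy of l1, and norms given by suprema *)

Section SignFunctionals.
Variables (R : realType) (X : normedModType R) (Y : set X).

(** Continuity of [S] at 0 gives a radius [d] below which |S x| < 1 on [Y]; scaling [T u] to norm d
    / 2 yields the factor 2 / d. *)
Lemma isomorphic_bounded_below (V : normedModType R) (T : {linear V -> X}) (S : X -> V) :
  range T = Y -> cancel T S -> {within Y, continuous S} ->
  exists2 B : R, 0 < B & forall u, `|u| <= B * `|T u|.
Proof.
move=> TY TK cS.
have Y0 : Y 0 by rewrite -TY; exists 0 => //; rewrite linear0.
have S0 : S 0 = 0 by rewrite -[X in S X](linear0 T) TK.
have : \forall x \near 0, Y x -> `|S x| < 1.
  have : \forall x \near within Y (nbhs (0 : X)), `|S x| < 1.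
    rewrite nbhs_subspace_in//.
    have : S @ nbhs_subspace (A := Y) 0 --> (0 : V) by rewrite -[X in _ --> X]S0; exact: cS.
    move=> SF; exact: (@cvgr0_norm_lt _ _ _ (nbhs_subspace (A := Y) 0) _ S SF 1 ltr01).
  by [].
move=> /nbhs_norm0P [d /= d0 Hd].
exists (2 / d) => [|u]; first by rewrite divr_gt0.
have [->|u0] := eqVneq u 0; first by rewrite normr0 mulr_ge0// divr_ge0// ltW.
have Tu0 : 0 < `|T u|.
  by rewrite normr_gt0; apply: contra_neq u0 => Tu; rewrite -(TK u) Tu S0.
have [a a0 aE] : exists2 a, 0 < a & a * `|T u| = d / 2.
  by exists (d / 2 / `|T u|); rewrite ?divr_gt0// divfK ?gt_eqF.
have SaT : S (a *: T u) = a *: u by rewrite -linearZ TK.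
have := Hd (a *: T u); rewrite SaT /= !normrZ (gtr0_norm a0) aE.
rewrite ltr_pdivrMr// ltr_pMr// ltr1n -(ler_pM2l a0) => /(_ isT) H.
have -> : a * (2 / d * `|T u|) = 1.
  by rewrite mulrCA aE mulrA divfK ?gt_eqF// mulfV ?pnatr_eq0.
by apply/ltW/H; rewrite -TY; exists (a *: u); rewrite // linearZ.
Qed.

(** The signed sum of the first [L] coordinates has norm at most 1 on l1, so on the range of [T] it
    is dominated by [B] times the norm; Hahn-Banach extends it. *)
Lemma sign_functionals (T : {linear l1 R -> X}) (B : R) : 0 < B ->
  (forall u, `|u| <= B * `|T u|) ->
  forall L (s : {ffun 'I_L -> bool}), exists k : dual X,
    (forall x, `|k x| <= B * `|x|) /\
    forall u, k (T u) = \sum_(i < L) sgnb R (s i) * u i.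
Proof.
move=> B0 TB L s.
pose phi (u : l1 R) := \sum_(i < L) sgnb R (s i) * u i.
have phiL a u v : phi (a *: u + v) = a * phi u + phi v.
  rewrite /phi mulr_sumr -big_split; apply: eq_bigr => i _ /=.
  rewrite mulrCA -mulrDr; congr (_ * _).
have phi_le u : phi u <= `|u|.
  apply: (le_trans (ler_norm _)); apply: (le_trans (ler_norm_sum _ _ _)).
  apply: le_trans (sum_le_l1_norm R u L); apply: ler_sum => i _.
  by rewrite normrM; case: (s i); rewrite /sgnb ?normrN normr1 mul1r.
pose p x := B * `|x : X|.
pose G := [set w : X * R | exists u, w = (T u, phi u)].
have [|||F [Fp FG]] := @Hahn_Banach R X p _ _ G _.
- by move=> x y; rewrite /p -mulrDr ler_pM2l// ler_normD.
- by move=> a x a0; rewrite /p normrZ gtr0_norm// mulrCA.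
- split.
  + exists 0; rewrite linear0 /phi big1// => i _.
    by rewrite mulr0.
  + move=> a _ _ [u ->] [v ->]; exists (a *: u + v); by rewrite linearP phiL.
  + by move=> _ [u ->] /=; apply: (le_trans (phi_le u)).
have F_le x : `|F x| <= B * `|x|.
  by rewrite ler_norml Fp andbT lerNl -linearN; apply: (le_trans (Fp _)); rewrite /p normrN.
have [k kE] := @dual_exists R X F B F_le.
exists k; split => [x|u]; first by rewrite kE.
by rewrite kE; apply: FG; exists u.
Qed.

Lemma norming_functional (x : X) : exists2 f : dual X,
  (forall z, `|f z| <= `|z|) & f x = `|x|.
Proof.
pose G := [set w : X * R | exists a, w = (a *: x, a * `|x|)].
have [|||F [Fp FG]] := @Hahn_Banach R X (fun z => `|z|) _ _ G _.
- by move=> u v; exact: ler_normD.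
- by move=> a u a0; rewrite normrZ gtr0_norm.
- split.
  + by exists 0; rewrite scale0r mul0r.
  + move=> a _ _ [b ->] [c ->]; exists (a * b + c).
    by rewrite /= scalerA -scalerDl mulrA -mulrDl.
  + by move=> _ [a ->] /=; rewrite normrZ ler_wpM2r// ler_norm.
have F_le z : `|F z| <= 1 * `|z|.
  by rewrite mul1r ler_norml Fp andbT lerNl -linearN; apply: (le_trans (Fp _)); rewrite normrN.
have [f fE] := @dual_exists R X F 1 F_le.
exists f; first by move=> z; rewrite fE -[leRHS]mul1r.
by rewrite fE; apply: FG; exists 1; rewrite scale1r mul1r.
Qed.

(** [N] is the supremum of the |l i x|, described by its universal property; the lower bound on the
    family is likewise phrased through its upper bounds [b]. *)
Lemma sup_equivalent_norm (I : Type) (i0 : I) (l : I -> dual X) (c C : R) :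
  0 < c -> 0 < C -> (forall i x, `|l i x| <= C * `|x|) ->
  (forall x b, (forall i, `|l i x| <= b) -> c * `|x| <= b) ->
  exists N : equivalent_norm X, [/\ forall i x, `|l i x| <= N x,
    forall x b, (forall i, `|l i x| <= b) -> N x <= b &
    forall x, c * `|x| <= N x].
Proof.
move=> c0 C0 l_le l_ge.
pose N x := sup [set `|l i x| | i in setT].
have lN i x : `|l i x| <= N x.
  by apply: ub_le_sup; [exists (C * `|x|) => _ [j _ <-] | exists i].
have NP x b : (forall i, `|l i x| <= b) -> N x <= b.
  by move=> lb; apply: ge_sup => [|_ [i _ <-]//]; exists `|l i0 x|, i0.
have ND x y : N (x + y) <= N x + N y.
  apply: NP => i; rewrite linearD; apply: (le_trans (ler_normD _ _)).
  by apply: lerD; exact: lN.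
have NZle a x : N (a *: x) <= `|a| * N x.
  by apply: NP => i; rewrite dualZ normrM ler_wpM2l.
have NZ a x : N (a *: x) = `|a| * N x.
  apply/eqP; rewrite eq_le NZle /=.
  have [->|a0] := eqVneq a 0.
    by rewrite normr0 mul0r; apply: le_trans (lN i0 _).
  rewrite -ler_pdivlMl ?normr_gt0// -normfV.
  by apply: le_trans (NZle _ _); rewrite scalerK.
have Nc x : c * `|x| <= N x by apply: l_ge => i; exact: lN.
have N0 x : N x = 0 -> x = 0.
  by have := Nc x => /[swap] ->; rewrite pmulr_rle0// normr_le0 => /eqP.
have Neq : exists c C : R, [/\ 0 < c, 0 < C & forall x, c * `|x| <= N x <= C * `|x|].
  by exists c, C; split => // x; rewrite Nc /=; apply: NP => i; exact: l_le.
by exists (EquivalentNorm ND NZ N0 Neq).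
Qed.

End SignFunctionals.

(** * The new norm and its generators *)

Section OctahedralRenorming.
Variables (R : realType) (X : normedModType R) (e : nat -> X) (A B : R).
Variable g : (nat -> R) -> dual X.
Hypotheses (A1 : 1 <= A) (B0 : 0 <= B) (e_le : forall n, `|e n| <= A).
Hypothesis gP : forall a, half_box R a ->
  [/\ forall x, `|g a x| <= B * `|x|, forall n, g a (e n) = a n &
    forall (c t : nat -> R) r x, half_box R c -> (forall n, `|t n| <= 1) -> (0 < r)%N ->
      `|\sum_(n < r ^ 2) t n * (g (update R a n (c n)) x - g a x)|
        <= 2 * (B * `|x|) * r%:R].

(** The index set of the functionals defining the norm. As [gen_h] vanishes on each [e n], the
    values there depend on [gen_a] and [gen_s] only. *)
Record generator := Generator {
  gen_a : nat -> R;
  gen_s : bool;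
  gen_h : dual X;
  gen_aP : half_box R gen_a;
  gen_h_le : forall x, `|gen_h x| <= `|x|;
  gen_h_e : forall n, gen_h (e n) = 0 }.

Definition gen_fun (i : generator) : dual X := sgnb R (gen_s i) *: g (gen_a i) + gen_h i.

Lemma gen_funE i x : gen_fun i x = sgnb R (gen_s i) * g (gen_a i) x + gen_h i x.
Proof. by []. Qed.

Lemma norm_sgnb b : `|sgnb R b| = 1.
Proof. by case: b; rewrite /sgnb ?normrN normr1. Qed.

Lemma sgnb_sqr b : sgnb R b * sgnb R b = 1.
Proof. by case: b; rewrite /sgnb ?mulrNN mulr1. Qed.

Lemma gen_fun_e i n : gen_fun i (e n) = sgnb R (gen_s i) * gen_a i n.
Proof. by rewrite gen_funE gen_h_e addr0; have [_ -> _] := gP _ (gen_aP i). Qed.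

Lemma gen_fun_le i x : `|gen_fun i x| <= (B + 1) * `|x|.
Proof.
rewrite gen_funE mulrDl mul1r; apply: (le_trans (ler_normD _ _)); apply: lerD.
  by rewrite normrM norm_sgnb mul1r; have [H _ _] := gP _ (gen_aP i).
exact: gen_h_le.
Qed.

Lemma half_box0 : half_box R (fun=> 0).
Proof. by move=> n; rewrite normr0 invr_ge0. Qed.

Definition gen0 : generator.
Proof.
by refine (@Generator (fun=> 0) true 0 half_box0 _ _) => // x; rewrite normr0.
Defined.

(** By this symmetry, one-sided bounds over all generators bound absolute values. *)
Definition gen_opp (i : generator) : generator.
Proof.
refine (@Generator (gen_a i) (~~ gen_s i) (- gen_h i) (gen_aP i) _ _).
- move=> x; have -> : (- gen_h i) x = - gen_h i x by [].
  by rewrite normrN; exact: gen_h_le.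
- move=> n; have -> : (- gen_h i) (e n) = - gen_h i (e n) by [].
  by rewrite gen_h_e oppr0.
Defined.

Lemma gen_oppE i x : gen_fun (gen_opp i) x = - gen_fun i x.
Proof.
rewrite !gen_funE opprD -mulNr; congr (_ * _ + _).
by rewrite /=; case: (gen_s i); rewrite /sgnb ?opprK.
Qed.

Lemma update_half_box a n b : half_box R a -> half_box R (update R a n (sgnb R b / 2)).
Proof.
move=> ha; apply: half_box_update => //.
by rewrite normrM norm_sgnb mul1r ger0_norm ?invr_ge0.
Qed.

(** The new coordinate carries the sign [gen_s], so that the two signs cancel and the value at 2 e_n
    is 1. *)
Definition gen_update (n : nat) (i : generator) : generator :=
  @Generator (update R (gen_a i) n (sgnb R (gen_s i) / 2)) (gen_s i) (gen_h i)
    (update_half_box _ n (gen_s i) (gen_aP i)) (@gen_h_le i) (gen_h_e i).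

Lemma gen_update_e n i : gen_fun (gen_update n i) (2 *: e n) = 1.
Proof.
by rewrite dualZ gen_fun_e /= /update eqxx [sgnb _ _ * _]mulrA sgnb_sqr mul1r mulfV ?pnatr_eq0.
Qed.

(** A bound for the norm of f - 2 A g_a when |f| <= 1; dividing by it gives an admissible
    [gen_h]. *)
Let D := 1 + 2 * A * B.

(* If f norms x, then f is a multiple of g_a plus a multiple of some h, with a
   proportional to (f (e n)); the two signs of g_a bound the terms separately. *)
Lemma gen_norming x b : (forall i, `|gen_fun i x| <= b) -> (2 * A + D)^-1 * `|x| <= b.
Proof.
move=> Hb.
have A0 : 0 < A by apply: lt_le_trans A1.
have A2 : 0 < 2 * A by rewrite mulr_gt0.
have D0 : 0 < D by rewrite ltr_wpDr// mulr_ge0// ltW.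
have [f f_le fx] := norming_functional R X x.
(* Since |f (e n)| <= A, this lies in the half box. *)
pose a n := f (e n) / (2 * A).
have ha : half_box R a.
  move=> n; rewrite normrM normfV (gtr0_norm A2) ler_pdivrMr// mulKf ?pnatr_eq0//.
  exact: le_trans (f_le _) (e_le n).
have [ga_le ga_e _] := gP _ ha.
pose h : dual X := D^-1 *: (f - (2 * A) *: g a).
have hE z : h z = D^-1 * (f z - 2 * A * g a z) by [].
have h_le z : `|h z| <= `|z|.
  rewrite hE normrM normfV (gtr0_norm D0) ler_pdivrMl//.
  apply: (le_trans (ler_normB _ _)).
  have -> : D * `|z| = `|z| + 2 * A * (B * `|z|) by rewrite /D; ring.
  by rewrite lerD// normrM (gtr0_norm A2) ler_pM2l.
have h_e n : h (e n) = 0.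
  by rewrite hE ga_e /a [2 * A * _]mulrC divfK ?gt_eqF// subrr mulr0.
have := Hb (Generator a true h ha h_le h_e).
have := Hb (Generator a false h ha h_le h_e).
rewrite !gen_funE /= mul1r mulN1r => H1 H2.
have AD0 : 0 < 2 * A + D by exact: addr_gt0.
rewrite mulrC ler_pdivrMr// -fx.
have -> : f x = 2 * A * g a x + D * h x.
  by rewrite hE mulrA mulfV ?gt_eqF// mul1r addrC subrK.
move: H1 H2; rewrite !ler_norml => /andP[? ?] /andP[? ?].
rewrite mulrDr; apply: lerD; rewrite [b * _]mulrC ler_pM2l//; lra.
Qed.

Lemma octahedral_renorming :
  exists N : equivalent_norm X, octahedral (dual (dual (renormed N))).
Proof.
have A0 : 0 < A by apply: lt_le_trans A1.
pose c := (2 * A + D)^-1.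
have c0 : 0 < c.
  by rewrite invr_gt0 addr_gt0 ?mulr_gt0// ltr_wpDr// mulr_ge0// mulr_ge0// ltW.
have B1 : 0 < B + 1 by rewrite ltr_wpDl.
have [N [lN NP Nc]] := sup_equivalent_norm R X generator gen0 gen_fun c (B + 1)
  c0 B1 gen_fun_le gen_norming.
exists N; set Z := renormed N.
have /choice[l lE] : forall i, exists l : dual Z, forall z : X, l z = gen_fun i z.
  move=> i.
  have lL : linear (gen_fun i : Z -> R^o) by move=> a u v; exact: (linearP (gen_fun i)).
  pose LL := GRing.isLinear.Build R Z R^o *:%R (gen_fun i : Z -> R^o) lL.
  pose L : {linear Z -> R^o} := HB.pack (gen_fun i : Z -> R^o) LL.
  have [|l lE] := @dual_exists R Z L 1; last by exists l.
  by move=> z; rewrite mul1r; exact: lN.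
have Nnorm (z : Z) : `|z| = N z by [].
(* The estimate for the [g a] is 2 B r times the old norm, which is at most N / c. *)
apply: (@perturb_octahedral_bidual R Z (2 * B / c)) => r r0.
exists (fun n => 2 *: e n : Z); split.
  move=> n; apply: NP => i; rewrite dualZ gen_fun_e !normrM norm_sgnb mul1r.
  rewrite ger0_norm// -ler_pdivlMl// mulr1; exact: gen_aP.
apply: (@perturb_norming R Z generator l gen0 _ _ _ (fun n i => gen_update n i)).
- by move=> i z; rewrite lE; apply: (le_trans (ler_norm _)); exact: lN.
- move=> z b Hb; apply: NP => i; rewrite ler_norml -lE Hb andbT lerNl.
  by rewrite lE -gen_oppE -lE.
- by rewrite mulr_ge0// divr_ge0 ?mulr_ge0// ltW.
- by move=> n i; rewrite lE gen_update_e.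
- move=> s s1 i z.
  pose t n := oapp s 0 (insub n).
  have t1 n : `|t n| <= 1 by rewrite /t; case: insubP => [j _ _|_] /=; rewrite ?normr0.
  have [_ _ /(_ (fun=> sgnb R (gen_s i) / 2) t r z)] := gP _ (gen_aP i).
  have hc : half_box R (fun=> sgnb R (gen_s i) / 2).
    by move=> n; rewrite normrM norm_sgnb mul1r ger0_norm ?invr_ge0.
  move=> /(_ hc t1 r0) H.
  (* The update keeps sign and [gen_h]: the [gen_h] cancel and the sign factors out. *)
  have -> : \sum_n s n * (l (gen_update n i) z - l i z) = sgnb R (gen_s i) *
      \sum_(n < r ^ 2) t n * (g (update R (gen_a i) n (sgnb R (gen_s i) / 2)) z - g (gen_a i) z).
    rewrite mulr_sumr; apply: eq_bigr => n _; rewrite !lE !gen_funE /= /t valK /=.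
    by rewrite opprD addrACA subrr addr0 -mulrBr mulrCA.
  apply: (le_trans (ler_norm _)); rewrite normrM norm_sgnb mul1r.
  apply: (le_trans H).
  have -> : 2 * (B * `|z : X|) * r%:R = 2 * B / c * r%:R * (c * `|z : X|).
    by field; rewrite gt_eqF.
  by rewrite ler_wpM2l// mulr_ge0// divr_ge0 ?mulr_ge0// ltW.
Qed.

End OctahedralRenorming.

(** * Assembly: from a copy of l1 to the octahedral renorming *)

Theorem theorem4p2 (R : realType) (X : completeNormedModType R)
  (sepX : separable X)
  (l1X : exists Y : set X, closed Y /\ isomorphic_to_subspace (l1 R) Y) :
  exists N : equivalent_norm X, octahedral (dual (dual (renormed N))).
Proof.
have [Y [_ [T [S [TY TK cT cS]]]]] := l1X.
have [B B0 TB] := isomorphic_bounded_below R X Y _ T S TY TK cS.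
have /choice[d dE] := l1_basis R.
have [A A1 TA] : exists2 A, 1 <= A & forall u, `|T u| <= A * `|u|.
  have /linear_boundedP/pinfty_ex_gt0[M M0 HM] := continuous_linear_bounded 0 (cT 0).
  (* Adding 1 to the bound of [T] ensures 1 <= A. *)
  exists (M + 1); first by rewrite lerDr ltW.
  by move=> u; apply: (le_trans (HM u)); rewrite ler_wpM2r// lerDl.
pose k L s := projT1 (cid (sign_functionals R X T B B0 TB L s)).
have kP L s := projT2 (cid (sign_functionals R X T B B0 TB L s)).
have k_e L s (i : 'I_L) : k L s ((T \o d) i) = sgnb R (s i).
  rewrite (kP L s).2 (bigD1 i)//= dE eqxx mulr1 big1 ?addr0// => j ji.
  by rewrite dE (negbTE (_ : nat_of_ord j != i)) ?mulr0.
have [g gP] := biased_functionals R X B (T \o d) k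
  (fun L s x => (kP L s).1 x) k_e.
apply: (octahedral_renorming R X (T \o d) A B g A1 (ltW B0) _ gP) => n.
apply: (le_trans (TA _)); rewrite ler_piMr ?(le_trans ler01)//.
exact: l1_basis_norm (dE n).
Qed.
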